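(* Let $T(n)$ be the number of topologies on $[n]=\{1,\ldots,n\}$ and $T_0(n)$ the number of $T_0$-topologies on $[n]$. Then (i) $T(n)$ and $T_0(n)$ are not C-finite; (ii) $T(n)$ and $T_0(n)$ are MC-finite.
   Context: A topology on $[n]$ is $T_0$ if for all distinct $a,b\in[n]$ there is an open set containing exactly one of them. A sequence of integers $s(n)$ is C-finite if there are $p,q\in\mathbb{N}$ and $c_0,\ldots,c_{p-1}\in\mathbb{Z}$ with $s(n+p)=\sum_{i=0}^{p-1}c_is(n+i)$ for all $n\ge q$. It is MC-finite if for every $m\in\mathbb{N}^+$ there are $p_m,q_m\in\mathbb{N}^+$ and $c_{i,m}\in\mathbb{Z}$ with $s(n+p_m)\equiv\sum_{i=0}^{p_m-1}c_{i,m}s(n+i)\pmod m$ for all $n\ge q_m$ (equivalently $s(n)\bmod m$ is ultimately periodic for all $m$). *)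

(* Defs.v *)
From mathcomp Require Import all_boot all_order all_algebra.

Set Implicit Arguments.
Unset Strict Implicit.
Unset Printing Implicit Defensive.

Definition is_topology (X : finType) (O : {set {set X}}) : bool :=
  [&& set0 \in O,
      setT \in O,
      [forall F : {set {set X}}, (F \subset O) ==> (cover F \in O)]
    & [forall U in O, forall V in O, U :&: V \in O]].

Definition is_T0 (X : finType) (O : {set {set X}}) : bool :=
  [forall a : X, forall b : X,
     (a != b) ==> [exists U in O, (a \in U) != (b \in U)]].

(* The n-element set {1, ..., n} is represented by 'I_n. *)
Definition num_topologies (n : nat) : nat :=
  #|[set O : {set {set 'I_n}} | is_topology O]|.

Definition num_T0_topologies (n : nat) : nat :=
  #|[set O : {set {set 'I_n}} | is_topology O & is_T0 O]|.

Local Open Scope ring_scope.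

Definition C_finite (s : nat -> int) : Prop :=
  exists (p q : nat) (c : 'I_p -> int),
    forall n : nat, (q <= n)%N ->
      s (n + p)%N = \sum_(i < p) c i * s (n + i)%N.

Definition MC_finite (s : nat -> int) : Prop :=
  forall m : nat, (0 < m)%N ->
    exists (p q : nat) (c : 'I_p -> int),
      [/\ (0 < p)%N, (0 < q)%N &
        forall n : nat, (q <= n)%N ->
          (s (n + p)%N = \sum_(i < p) c i * s (n + i)%N %[mod m%:Z])%Z].

(* Main.v *)
(* Finite topologies are preorders (of specialization) and T0 topologies are
   partial orders, so let s(a, b) be the number of preorders on a + b points whose
   last b points are alone in their equivalence class: T(n) = s(n, 0) and
   T0(n) = s(0, n).  Write E and F for the shifts of a and b.

   Fix a prime p and adjoin K blocks of p points, each with its cyclic rotation. A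
   preorder fixed by the rotation of a block is constant along it and induces on it
   either the discrete or the full preorder, so the block can be collapsed to a point,
   isolated or not. By inclusion-exclusion (E^p - E - F)^K s, or (F^p - F)^K s when the
   block points are isolated, counts the preorders fixed by none of the K rotations.
   The rotations generate an action of (Z/p)^K. As invariance of a binary relation is a
   condition on pairs of points, each coordinate of the stabilizer of such a preorder
   vanishes or is tied to another coordinate; so the stabilizer has codimension at
   least K/2, and p^r divides the count if K = 2r. Eliminating F shows that s(n, 0)
   satisfies a monic linear recurrence modulo p^r with characteristic polynomial a power
   of (X^p - X)^p - (X^p - X), and s(0, n) one with a power of X^p - X; products over
   the primes give all moduli.

   Bipartite orders show T0(2k) >= 2^(k^2), whereas C-finite sequences grow at most
   exponentially. *)

From HB Require Import structures.
Require Import Defs.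
From mathcomp Require Import all_boot all_order all_algebra all_fingroup.
From mathcomp Require Import ring zify.

Set Implicit Arguments.
Unset Strict Implicit.
Unset Printing Implicit Defensive.

Import GRing.Theory.

(** * Topologies as preorders *)

Lemma card_in_can (T1 T2 : finType) (S1 : {set T1}) (S2 : {set T2})
    (f : T1 -> T2) (g : T2 -> T1) :
  {in S1, forall x, f x \in S2} -> {in S2, forall y, g y \in S1} ->
  {in S1, cancel f g} -> {in S2, cancel g f} -> #|S1| = #|S2|.
Proof.
move=> fS gS fK gK; apply/eqP; rewrite eqn_leq; apply/andP; split.
  rewrite -(card_in_imset (can_in_inj fK)); apply: subset_leq_card.
  by apply/subsetP=> _ /imsetP[x xS ->]; apply: fS.
rewrite -(card_in_imset (can_in_inj gK)); apply: subset_leq_card.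
by apply/subsetP=> _ /imsetP[x xS ->]; apply: gS.
Qed.

(* A preorder on the subset A, encoded as a preorder on the whole type in which
   the points outside A are comparable only to themselves; every point of B is
   alone in its equivalence class. *)
Definition preorder_on (T : finType) (A B : {set T}) (R : {set T * T}) : bool :=
  [&& [forall x, (x, x) \in R],
      [forall x, forall y, forall z,
         ((x, y) \in R) ==> ((y, z) \in R) ==> ((x, z) \in R)],
      [forall x, forall y, ((x, y) \in R) ==> (x != y) ==> (x \in A) && (y \in A)]
    & [forall x in B, forall y, ((x, y) \in R) ==> ((y, x) \in R) ==> (x == y)]].

Lemma preorder_onP (T : finType) (A B : {set T}) (R : {set T * T}) :
  reflect [/\ forall x, (x, x) \in R,
              forall x y z, (x, y) \in R -> (y, z) \in R -> (x, z) \in R,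
              forall x y, (x, y) \in R -> x != y -> (x \in A) && (y \in A)
            & forall x y, x \in B -> (x, y) \in R -> (y, x) \in R -> x = y]
          (preorder_on A B R).
Proof.
apply: (iffP and4P) => [[h1 h2 h3 h4]|[h1 h2 h3 h4]]; split.
- exact/forallP.
- by move=> x y z; have /forallP/(_ x)/forallP/(_ y)/forallP/(_ z) := h2;
    move=> /implyP h /h /implyP.
- by move=> x y; have /forallP/(_ x)/forallP/(_ y) := h3; move=> /implyP h /h /implyP.
- move=> x y xB; have /forallP/(_ x)/implyP/(_ xB)/forallP/(_ y) := h4.
  by move=> /implyP h /h /implyP k /k /eqP.
- exact/forallP.
- by apply/'forall_'forall_forallP=> x y z; apply/implyP=> h; apply/implyP; apply: h2.
- by apply/'forall_forallP=> x y; apply/implyP=> h; apply/implyP; apply: h3.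
- apply/forall_inP=> x xB; apply/forallP=> y; apply/implyP=> h; apply/implyP=> h'.
  by apply/eqP; apply: h4.
Qed.

Definition num_preorders (a b : nat) : nat :=
  #|[set R : {set ('I_a + 'I_b) * ('I_a + 'I_b)} |
     preorder_on setT [set inr i | i : 'I_b] R]|.

(** Relations are pulled back along [h], or pushed forward with the diagonal added; points outside
    [A] are comparable only to themselves, so nothing is lost. *)
Lemma card_preorder_on_transport (T1 T2 : finType) (A B : {set T1}) (B2 : {set T2})
    (h : T2 -> T1) :
  injective h -> (forall x, (x \in A) = (x \in codom h)) ->
  (forall y, (h y \in B) = (y \in B2)) -> B \subset A ->
  #|[set R | preorder_on A B R]| = #|[set R | preorder_on setT B2 R]|.
Proof.
move=> hI hA hB sBA.
pose f (R : {set T1 * T1}) := [set xy : T2 * T2 | (h xy.1, h xy.2) \in R].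
pose g (R : {set T2 * T2}) := [set xy : T1 * T1 |
   (xy.1 == xy.2) || [exists uv in R, (h uv.1, h uv.2) == xy]].
have gE R x y : ((h x, h y) \in g R) = (x == y) || ((x, y) \in R).
  rewrite inE /= (inj_eq hI); congr orb; apply/exists_inP/idP.
    by case=> [[u v]] uvR /= /eqP[/hI <- /hI <-].
  by move=> xyR; exists (x, y).
have gP R x y : (x, y) \in g R -> x = y \/
    exists u v, [/\ x = h u, y = h v & (u, v) \in R].
  rewrite inE /= => /orP[/eqP->|/exists_inP[[u v] uvR /eqP[<- <-]]]; first by left.
  by right; exists u, v.
apply: (@card_in_can _ _ _ _ f g) => R; rewrite !inE => /preorder_onP[r1 r2 r3 r4].
- apply/preorder_onP; split=> [x|x y z|x y|x y]; rewrite ?inE //=.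
  + exact: r2.
  + by rewrite -hB => xB xy yx; apply: hI; apply: r4.
- apply/preorder_onP; split=> [x|x y z|x y|x y].
  + by rewrite inE eqxx.
  + move=> /gP[->//|[u [v [-> -> uv]]]] /gP[<-|[u' [v' [/hI e -> uv']]]].
      by rewrite gE uv orbT.
    by rewrite -e in uv'; rewrite gE (r2 _ _ _ uv uv') orbT.
  + by move=> /gP[->|[u [v [-> -> uv]]]]; rewrite ?eqxx // !hA !codom_f.
  + move=> xB; have := subsetP sBA _ xB; rewrite hA => /codomP[u ux].
    rewrite ux hB in xB *; move=> /gP[//|[u' [v [/hI <- -> uv]]]].
    by rewrite gE => /orP[/eqP-> //|vu]; rewrite (r4 _ _ xB uv vu).
- apply/setP=> -[x y]; apply/idP/idP.
    move=> /gP[->//|[u [v [-> -> ]]]]; by rewrite inE.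
  have [->|nxy xy] := eqVneq x y; first by rewrite !inE eqxx.
  have /andP[] := r3 _ _ xy nxy; rewrite !hA => /codomP[u ux] /codomP[v vy].
  by rewrite ux vy gE inE /= -ux -vy xy orbT.
- apply/setP=> -[x y]; rewrite inE gE /=.
  by case: eqVneq => [->|//]; rewrite r1.
Qed.

(** Only the two cardinalities matter, so blocks can be collapsed inside one fixed type by shrinking
    [A]. *)
Lemma card_preorder_on (T : finType) (A B : {set T}) : B \subset A ->
  #|[set R | preorder_on A B R]| = num_preorders #|A :\: B| #|B|.
Proof.
move=> sBA.
pose h (u : 'I_#|A :\: B| + 'I_#|B|) : T :=
  match u with inl i => enum_val i | inr i => enum_val i end.
have hB u : (h u \in B) = (u \in [set inr i | i : 'I_#|B|]).
  case: u => i /=; last by rewrite enum_valP imset_f.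
  by apply/idP/imsetP=> [|[]//]; have := enum_valP i; rewrite inE => /andP[/negbTE->].
apply: (card_preorder_on_transport _ _ hB sBA) => [u v e|x].
  have := hB u; rewrite e hB; case: u v e => [i|i] [j|j] //= e.
  - by move: e => /enum_val_inj ->.
  - by rewrite imset_f // => /esym /imsetP[].
  - by rewrite imset_f // => /imsetP[].
  - by move: e => /enum_val_inj ->.
apply/idP/codomP=> [xA|[u ->]].
  have [xB|xB] := boolP (x \in B).
    by exists (inr (enum_rank_in xB x)); rewrite /= enum_rankK_in.
  have xAB : x \in A :\: B by rewrite inE xB.
  by exists (inl (enum_rank_in xAB x)); rewrite /= enum_rankK_in.
case: u => i /=; first by have := enum_valP i; rewrite inE => /andP[].
exact: (subsetP sBA _ (enum_valP i)).
Qed.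

(** * The correspondence between finite topologies and preorders *)

Definition specialization (X : finType) (O : {set {set X}}) : {set X * X} :=
  [set xy | [forall U in O, (xy.1 \in U) ==> (xy.2 \in U)]].

Definition upsets (X : finType) (R : {set X * X}) : {set {set X}} :=
  [set U : {set X} | [forall x in U, forall y, ((x, y) \in R) ==> (y \in U)]].

Lemma specializationP (X : finType) (O : {set {set X}}) x y :
  reflect (forall U, U \in O -> x \in U -> y \in U) ((x, y) \in specialization O).
Proof.
rewrite inE; apply: (iffP forall_inP) => h U UO; first exact/implyP/h.
by apply/implyP; apply: h.
Qed.

Lemma upsetsP (X : finType) (R : {set X * X}) (U : {set X}) :
  reflect (forall x y, x \in U -> (x, y) \in R -> y \in U) (U \in upsets R).
Proof.
rewrite inE; apply: (iffP forall_inP) => [h x y xU|h x xU].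
  by have /forallP/(_ y)/implyP := h x xU.
by apply/forallP=> y; apply/implyP; apply: h.
Qed.

Lemma upsets_topology (X : finType) (R : {set X * X}) : is_topology (upsets R).
Proof.
apply/and4P; split.
- by apply/upsetsP=> x y; rewrite inE.
- by apply/upsetsP=> x y; rewrite !inE.
- apply/forallP=> F; apply/implyP=> /subsetP FO; apply/upsetsP=> x y.
  case/bigcupP=> U UF xU xy; apply/bigcupP; exists U => //.
  by have /upsetsP := FO _ UF; apply; first exact: xU.
- apply/forall_inP=> U /upsetsP UO; apply/forall_inP=> V /upsetsP VO.
  by apply/upsetsP=> x y; rewrite !inE => /andP[xU xV] xy; rewrite (UO x) // (VO x).
Qed.

Lemma specializationK (X : finType) (O : {set {set X}}) :
  is_topology O -> upsets (specialization O) = O.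
Proof.
case/and4P=> _ OT /forallP Ocup /forall_inP Ocap; apply/setP=> U.
apply/idP/idP=> [/upsetsP Uup|UO].
  (* [N x] is the least neighbourhood of [x], open by finiteness; an up-closed set is the union of
     those of its points. *)
  pose N x := \bigcap_(V in O | x \in V) V.
  have NO x : N x \in O.
    apply: (big_ind (fun V => V \in O)) => // [V W VO WO|V /andP[]//].
    by have /forall_inP := Ocap _ VO; apply.
  have xN x : x \in N x by apply/bigcapP=> V /andP[].
  suff -> : U = cover [set N x | x in U].
    apply: (implyP (Ocup _)); apply/subsetP=> _ /imsetP[x _ ->]; exact: NO.
  apply/setP=> y; apply/idP/bigcupP=> [yU|[_ /imsetP[x xU ->] yN]].
    by exists (N y); rewrite ?imset_f.
  apply: (Uup x) => //; apply/specializationP=> V VO xV.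
  by move/bigcapP: yN; apply; rewrite VO.
by apply/upsetsP=> x y xU /specializationP; apply.
Qed.

Lemma upsetsK (X : finType) (B : {set X}) (R : {set X * X}) :
  preorder_on setT B R -> specialization (upsets R) = R.
Proof.
case/preorder_onP=> r1 r2 _ _; apply/setP=> -[x y].
apply/specializationP/idP=> [h|xy U /upsetsP UR xU]; last exact: UR xy.
suff: y \in [set z | (x, z) \in R] by rewrite inE.
apply: h; last by rewrite inE.
by apply/upsetsP=> u v; rewrite !inE; apply: r2.
Qed.

Lemma preorder_on_specialization (X : finType) (O : {set {set X}}) :
  preorder_on setT set0 (specialization O).
Proof.
apply/preorder_onP; split=> [x|x y z|x y|x y].
- exact/specializationP.
- move=> /specializationP xy /specializationP yz.
  by apply/specializationP=> U UO xU; apply: yz => //; apply: xy.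
- by rewrite !inE.
- by rewrite inE.
Qed.

Lemma preorder_on_specialization_T0 (X : finType) (O : {set {set X}}) :
  preorder_on setT setT (specialization O) = is_T0 O.
Proof.
have /preorder_onP[r1 r2 r3 _] := preorder_on_specialization O.
apply/preorder_onP/'forall_forallP=> [[_ _ _ r4] x y|h].
  apply/implyP; apply: contraNT; rewrite negb_exists_in => /forall_inP xyO.
  have eqO U : U \in O -> (x \in U) = (y \in U).
    by move=> /xyO; rewrite negbK => /eqP.
  by apply/eqP; apply: r4; rewrite ?in_setT //; apply/specializationP=> U /eqO ->.
split=> // x y _ /specializationP xy /specializationP yx; apply/eqP.
apply: contraTT isT => nxy; have /implyP/(_ nxy)/exists_inP[U UO] := h x y.
by case: (boolP (x \in U)) => [/(xy U UO)->|nx] //; case: (boolP (y \in U)) nx => // /(yx U UO)->.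
Qed.

Lemma num_topologiesE n : num_topologies n = num_preorders n 0.
Proof.
have := card_preorder_on (sub0set [set: 'I_n]).
rewrite setD0 cardsT card_ord cards0 => <-.
apply: (@card_in_can _ _ _ _ (@specialization _) (@upsets _)) => R; rewrite !inE.
- by move=> _; apply: preorder_on_specialization.
- by move=> _; apply: upsets_topology.
- exact: specializationK.
- exact: upsetsK.
Qed.

Lemma num_T0_topologiesE n : num_T0_topologies n = num_preorders 0 n.
Proof.
have := card_preorder_on (subxx [set: 'I_n]).
rewrite setDv cardsT card_ord cards0 => <-.
apply: (@card_in_can _ _ _ _ (@specialization _) (@upsets _)) => R; rewrite !inE.
- by case/andP=> _; rewrite preorder_on_specialization_T0.
- move=> Rpre; rewrite upsets_topology -preorder_on_specialization_T0.
  by rewrite (upsetsK Rpre).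
- by case/andP=> h _; apply: specializationK.
- exact: upsetsK.
Qed.

(* The points of the left half are put below those of the right half along an
   arbitrary bipartite relation. *)
Lemma num_preorders_lower_bound k : 2 ^ (k * k) <= num_preorders 0 (k + k).
Proof.
have := card_preorder_on (subxx [set: 'I_k + 'I_k]).
rewrite setDv cardsT card_sum card_ord cards0 => <-.
have -> : 2 ^ (k * k) = #|powerset [set: 'I_k * 'I_k]|.
  by rewrite card_powerset cardsT card_prod card_ord.
pose f (S : {set 'I_k * 'I_k}) : {set ('I_k + 'I_k) * ('I_k + 'I_k)} :=
  [set xy | (xy.1 == xy.2) ||
     match xy with (inl i, inr j) => (i, j) \in S | _ => false end].
have fI : injective f.
  by move=> S S' /setP e; apply/setP=> -[i j]; have := e (inl i, inr j); rewrite !inE.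
rewrite -(card_imset _ fI); apply: subset_leq_card.
apply/subsetP=> _ /imsetP[S _ ->]; rewrite inE; apply/preorder_onP; split.
- by move=> x; rewrite inE eqxx.
- move=> x y z; rewrite !inE /=.
  case: eqVneq => [->//|_]; case: (eqVneq y z) => [<- /= h _|_].
    by rewrite h orbT.
  by case: x y => [i|i] [j|j].
- by move=> x y; rewrite !inE.
- by move=> x y _; rewrite !inE /=; case: eqVneq => // _; case: x y => [i|i] [j|j].
Qed.

(** * Collapsing blocks *)

Section Blocks.

Variables (p : nat) (X : finType) (K : nat).
Hypothesis p_prime : prime p.

Local Open Scope ring_scope.

Local Notation pt := (X + 'I_K * 'F_p)%type.
Local Notation rel_set := {set pt * pt}.

(** Row vectors over the prime field serve as the group of block rotations, which makes scalar
    multiples available. *)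
Definition brot (g : 'rV['F_p]_K) (x : pt) : pt :=
  match x with inl _ => x | inr (i, t) => inr (i, t + g 0 i) end.

Definition rot_fixed (g : 'rV['F_p]_K) (R : rel_set) : bool :=
  [forall x, forall y, ((brot g x, brot g y) \in R) == ((x, y) \in R)].

Local Notation gen i := (delta_mx (0 : 'I_1) i : 'rV['F_p]_K).

Definition block (i : 'I_K) : {set pt} := [set inr (i, t) | t : 'F_p].

Definition collapse (i : 'I_K) (x : pt) : pt :=
  match x with inl _ => x | inr (j, _) => if j == i then inr (i, 0) else x end.

Lemma brot0 x : brot 0 x = x.
Proof. by case: x => [//|[i t]] /=; rewrite mxE addr0. Qed.

Lemma brotD (g h : 'rV['F_p]_K) x : brot (g + h) x = brot h (brot g x).
Proof. by case: x => [//|[i t]] /=; rewrite mxE addrA. Qed.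

Lemma rot_fixedP g (R : rel_set) :
  reflect (forall x y, ((brot g x, brot g y) \in R) = ((x, y) \in R)) (rot_fixed g R).
Proof. by apply: (iffP 'forall_'forall_eqP). Qed.

Lemma rot_fixed_mulrn g R n : rot_fixed g R -> rot_fixed (g *+ n) R.
Proof.
move=> /rot_fixedP gR; apply/rot_fixedP; elim: n => [|n IHn] x y.
  by rewrite mulr0n !brot0.
by rewrite mulrS !brotD IHn gR.
Qed.

Lemma Fp_natr (c : 'F_p) : exists n : nat, c = n%:R.
Proof. by exists c; rewrite natr_Zp. Qed.

Lemma rot_fixed_scale g R c : rot_fixed g R -> rot_fixed (c *: g) R.
Proof.
by move=> gR; have [n ->] := Fp_natr c; rewrite scaler_nat; apply: rot_fixed_mulrn.
Qed.

Lemma blockP i x : reflect (exists t, x = inr (i, t)) (x \in block i).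
Proof. by apply: (iffP imsetP) => [[t _ ->]|[t ->]]; exists t. Qed.

Lemma mem_block i j t : ((inr (j, t) : pt) \in block i) = (j == i).
Proof.
by apply/blockP/eqP => [[u [-> _]]//|->]; exists t.
Qed.

Lemma collapse_block i x : x \in block i -> collapse i x = inr (i, 0).
Proof. by case/blockP=> t -> /=; rewrite eqxx. Qed.

Lemma collapse_notin i x : x \notin block i -> collapse i x = x.
Proof. by case: x => [//|[j t]]; rewrite mem_block /= => /negbTE ->. Qed.

Lemma mem_block_collapse i x : (collapse i x \in block i) = (x \in block i).
Proof.
have [xi|xi] := boolP (x \in block i); last by rewrite collapse_notin // (negbTE xi).
by rewrite collapse_block // mem_block eqxx.
Qed.

Lemma collapseK i x : collapse i (collapse i x) = collapse i x.
Proof.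
have [xi|xi] := boolP (x \in block i); last by rewrite !collapse_notin.
by rewrite (collapse_block xi) collapse_block ?mem_block.
Qed.

Lemma collapse_eq i x y : collapse i x = collapse i y -> x != y ->
  (x \in block i) && (y \in block i).
Proof.
move=> e; have := mem_block_collapse i x; rewrite e mem_block_collapse => bxy.
rewrite -bxy andbb; case: (boolP (y \in block i)) bxy => // yi /esym/negbT xi.
by rewrite -(collapse_notin xi) e collapse_notin // eqxx.
Qed.

Lemma collapse_rot i j x :
  collapse i (brot (gen j) x) = if i == j then collapse i x else brot (gen j) (collapse i x).
Proof.
case: x => [x|[k t]] /=; first by rewrite if_same.
case: (eqVneq k i) => [_|ki] /=.
  by case: eqVneq => //= ij; rewrite mxE eqxx /= (negbTE ij) addr0.
by case: eqVneq => //= <-; rewrite mxE (negbTE ki) andbF addr0.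
Qed.

Lemma rot_gen_scale i c t : brot (c *: gen i) (inr (i, t)) = inr (i, t + c).
Proof. by rewrite /= !mxE !eqxx mulr1. Qed.

Lemma rot_gen_scale_notin i c x : x \notin block i -> brot (c *: gen i) x = x.
Proof.
case: x => [//|[j t]]; rewrite mem_block /= !mxE => /negbTE ->.
by rewrite andbF mulr0 addr0.
Qed.

(** A multiple of the rotation moves the point in block [i] to its representative and fixes the
    other point, which lies outside the block. *)
Lemma rot_fixed_collapse i R x y : rot_fixed (gen i) R ->
  ~~ ((x \in block i) && (y \in block i)) ->
  ((collapse i x, collapse i y) \in R) = ((x, y) \in R).
Proof.
move=> iR; have [/blockP[t ->]|xi] /= := boolP (x \in block i).
  rewrite eqxx => yi; rewrite collapse_notin //.
  have /rot_fixedP/(_ (inr (i, 0)) y) := rot_fixed_scale t iR.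
  by rewrite rot_gen_scale add0r rot_gen_scale_notin // => ->.
move=> _; rewrite (collapse_notin xi).
have [/blockP[t ->]|yi] /= := boolP (y \in block i); last by rewrite collapse_notin.
rewrite eqxx; have /rot_fixedP/(_ x (inr (i, 0))) := rot_fixed_scale t iR.
by rewrite rot_gen_scale add0r rot_gen_scale_notin // => ->.
Qed.

(* The differences of comparable points form a nonzero subgroup of the field. *)
Lemma rot_fixed_full A B i R s t u v : preorder_on A B R -> rot_fixed (gen i) R ->
  s != t -> (inr (i, s), inr (i, t)) \in R -> (inr (i, u), inr (i, v)) \in R.
Proof.
case/preorder_onP=> r1 r2 _ _ iR nst stR; pose d := t - s.
have d0 : d != 0 by rewrite subr_eq0 eq_sym.
have step w : (inr (i, w), inr (i, w + d)) \in R.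
  have /rot_fixedP/(_ (inr (i, s)) (inr (i, t))) := rot_fixed_scale (w - s) iR.
  rewrite !rot_gen_scale stR [s + _]addrC subrK.
  by move=> h; rewrite /d addrCA.
have steps n w : (inr (i, w), inr (i, w + d *+ n)) \in R.
  elim: n => [|n IHn]; first by rewrite mulr0n addr0.
  by apply: r2 IHn _; rewrite mulrSr addrA.
have [n nE] := Fp_natr ((v - u) / d).
have := steps n u; rewrite -mulr_natr -nE mulrC divfK //.
by rewrite addrC subrK.
Qed.

Definition unfixed_preorders (A B : {set pt}) (J : seq 'I_K) : {set rel_set} :=
  [set R | preorder_on A B R && all (fun i => ~~ rot_fixed (gen i) R) J].

(** The flag [b] says that the block is full. The representative of a discrete block must be
    isolated: were it equivalent to a point outside, invariance would make the whole block
    equivalent. *)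
Definition collapsed_isolated (b : bool) (i : 'I_K) (B : {set pt}) : {set pt} :=
  if b then B :\: block i else inr (i, 0) |: (B :\: block i).

(** Distinct points are compared through their representatives, except that [b] decides for two
    points of block [i]. *)
Definition expand_rel (b : bool) (i : 'I_K) (R : rel_set) : rel_set :=
  [set xy | (xy.1 == xy.2) || (b || (collapse i xy.1 != collapse i xy.2)) &&
                              ((collapse i xy.1, collapse i xy.2) \in R)].

Definition restrict_rel (i : 'I_K) (R : rel_set) : rel_set :=
  [set xy | (xy.1 == xy.2) ||
     [&& collapse i xy.1 == xy.1, collapse i xy.2 == xy.2 & xy \in R]].

(** By [rot_fixed_full], the pair of labels 0 and 1 alone tells a full block from a discrete one. *)
Definition fixed_preorders (b : bool) (i : 'I_K) (A B : {set pt}) (J : seq 'I_K) :=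
  [set R in unfixed_preorders A B J |
     rot_fixed (gen i) R & ((inr (i, 0), inr (i, 1)) \in R) == b].

Lemma Fp_01 : (0 : 'F_p) != 1.
Proof. by rewrite eq_sym oner_eq0. Qed.

Lemma expand_rel_live b i A B R x y : preorder_on A B R ->
  collapse i x = x -> collapse i y = y ->
  ((x, y) \in expand_rel b i R) = ((x, y) \in R).
Proof.
case/preorder_onP=> r1 _ _ _ cx cy; rewrite inE /= cx cy.
by have [->|] := eqVneq x y; rewrite ?r1 // orbT.
Qed.

Lemma restrict_rel_live i A B R x y : preorder_on A B R ->
  collapse i x = x -> collapse i y = y ->
  ((x, y) \in restrict_rel i R) = ((x, y) \in R).
Proof.
case/preorder_onP=> r1 _ _ _ cx cy; rewrite inE /= cx cy !eqxx /=.
by have [->|] := eqVneq x y; rewrite ?r1.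
Qed.

(** The rotation of block [j] commutes with the collapse of block [i], so the conditions on the
    other blocks survive the collapse. *)
Lemma rot_fixed_expand b i j (A B : {set pt}) (R : rel_set) :
  preorder_on [set x in A | collapse i x == x] B R -> i != j ->
  rot_fixed (gen j) (expand_rel b i R) = rot_fixed (gen j) R.
Proof.
move=> Rpre nij; have [r1 r2 r3 r4] := preorder_onP _ _ _ Rpre.
have rotI : injective (brot (gen j)).
  by move=> x y /(congr1 (brot (- gen j))); rewrite -!brotD subrr !brot0.
have cr x : collapse i (brot (gen j) x) = brot (gen j) (collapse i x).
  by rewrite collapse_rot (negbTE nij).
apply/rot_fixedP/rot_fixedP=> [h x y|h x y]; last by rewrite !inE /= !cr h !(inj_eq rotI).
have [->|nxy] := eqVneq x y; first by rewrite !r1.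
have [cx|ncx] := eqVneq (collapse i x) x; last first.
  apply/idP/idP=> xy; have [] := andP (r3 _ _ xy _); rewrite ?(inj_eq rotI) //.
    by rewrite !inE !cr !(inj_eq rotI) (negbTE ncx) andbF.
  by rewrite !inE (negbTE ncx) andbF.
have [cy|ncy] := eqVneq (collapse i y) y; last first.
  apply/idP/idP=> xy; have [] := andP (r3 _ _ xy _); rewrite ?(inj_eq rotI) //.
    by rewrite !inE !cr !(inj_eq rotI) (negbTE ncy) andbF.
  by rewrite !inE (negbTE ncy) andbF.
by have := h x y; rewrite !(expand_rel_live _ Rpre) // ?cr ?cx ?cy.
Qed.

Lemma expand_relP (b : bool) i (A B : {set pt}) (R : rel_set) :
  block i \subset A -> (b -> [disjoint block i & B]) ->
  preorder_on [set x in A | collapse i x == x] (collapsed_isolated b i B) R ->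
  [/\ preorder_on A B (expand_rel b i R), rot_fixed (gen i) (expand_rel b i R)
    & ((inr (i, 0), inr (i, 1)) \in expand_rel b i R) = b].
Proof.
move=> sA dB Rpre; have [r1 r2 r3 r4] := preorder_onP _ _ _ Rpre.
have cA x : collapse i x \in A -> x \in A.
  have [/(subsetP sA)//|xi] := boolP (x \in block i).
  by rewrite collapse_notin.
split.
- apply/preorder_onP; split.
  + by move=> x; rewrite inE eqxx.
  + move=> x y z; rewrite !inE /=; case: (eqVneq x y) => [->//|nxy] /=.
    case: (eqVneq y z) => [<- -> _|nyz] /=; first by rewrite orbT.
    case/andP=> bxy xy /andP[byz yz]; rewrite (r2 _ _ _ xy yz) andbT.
    (* In the discrete case, if [x] and [z] lay in the block, its representative would be equivalent
       to that of [y]; being isolated, it would equal it. *)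
    case: (eqVneq x z) => //= nxz; case: (b) bxy r4 => //= nc r4.
    apply: contraNneq nc => exz; apply/eqP; apply: r4 => //; last by rewrite exz.
    have /andP[xi _] := collapse_eq exz nxz.
    by rewrite inE collapse_block // inE eqxx.
  + move=> x y; rewrite inE /=; case: eqVneq => //= nxy /andP[_ xy] _.
    case: (eqVneq (collapse i x) (collapse i y)) => [e|ne].
      by have /andP[/(subsetP sA) -> /(subsetP sA) ->] := collapse_eq e nxy.
    have /andP[] := r3 _ _ xy ne; rewrite !inE.
    by move=> /andP[/cA -> _] /andP[/cA ->].
  + move=> x y xB; rewrite !inE /= [y == x]eq_sym [collapse i y == _]eq_sym.
    case: eqVneq => //= nxy /andP[bc xy] /andP[_ yx].
    have e : collapse i x = collapse i y.
      apply: r4 => //; rewrite /collapsed_isolated; have [xi|xi] := boolP (x \in block i).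
        case: (b) dB => [/(_ isT) dB|_]; last by rewrite collapse_block // setU11.
        by rewrite (disjointFr dB xi) in xB.
      by rewrite collapse_notin //; case: (b); rewrite !inE xi xB ?orbT.
    have /andP[xi _] := collapse_eq e nxy; rewrite e eqxx orbF in bc.
    by have := dB bc => dB'; rewrite (disjointFr dB' xi) in xB.
- apply/rot_fixedP=> x y; rewrite !inE /= !collapse_rot eqxx; congr orb.
  apply/eqP/eqP=> [/(congr1 (brot (- gen i)))|-> //].
  by rewrite -!brotD subrr !brot0.
- rewrite inE /= !eqxx /= r1 andbT orbF.
  by case: eqP => // -[/eqP]; rewrite (negbTE Fp_01).
Qed.

Lemma restrict_relP b i (A B : {set pt}) (R : rel_set) : block i \subset A ->
  preorder_on A B R -> rot_fixed (gen i) R ->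
  ((inr (i, 0), inr (i, 1)) \in R) = b ->
  preorder_on [set x in A | collapse i x == x] (collapsed_isolated b i B)
    (restrict_rel i R) /\ expand_rel b i (restrict_rel i R) = R.
Proof.
move=> sA Rpre iR z01; have [r1 r2 r3 r4] := preorder_onP _ _ _ Rpre.
split.
  apply/preorder_onP; split.
  - by move=> x; rewrite inE eqxx.
  - move=> x y z; rewrite !inE /=; case: (eqVneq x y) => [->//|nxy] /=.
    case: (eqVneq y z) => [<- -> _|nyz] /=; first by rewrite orbT.
    by move=> /and3P[-> _ xy] /and3P[_ -> yz]; rewrite (r2 _ _ _ xy yz) orbT.
  - move=> x y; rewrite !inE /=; case: (eqVneq x y) => //= nxy /and3P[-> -> xy] _.
    by rewrite !andbT; apply: r3.
  - move=> x y xB; rewrite !inE /= [y == x]eq_sym; case: (eqVneq x y) => //= nxy.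
    move=> /and3P[/eqP cx /eqP cy xy] /and3P[_ _ yx].
    case: (boolP (x \in block i)) => xi; last first.
      apply: r4 => //; move: xB; rewrite /collapsed_isolated.
      case: (b); rewrite !inE xi //= => /orP[/eqP xz|//].
      by rewrite xz mem_block eqxx in xi.
    have yi : y \notin block i.
      apply: contraNN nxy => yi.
      by rewrite -cx -cy !collapse_block.
    have xE : x = inr (i, 0) by rewrite -cx collapse_block.
    move: xB; rewrite /collapsed_isolated; case: (b) z01 => z01.
      by rewrite !inE xi.
    (* If the representative is equivalent to a point [y] outside the block, invariance puts [y]
       below label 1 as well, and the block is not discrete. *)
    have [c1 c2] : (inr (i, 0), y) \in R /\ (y, inr (i, 1)) \in R.
      rewrite -xE; split=> //.
      rewrite -(rot_fixed_collapse iR) ?(negbTE yi) //= eqxx -xE.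
      by rewrite (collapse_notin yi).
    by rewrite (r2 _ _ _ c1 c2) in z01.
apply/setP=> -[x y]; rewrite inE /=.
case: (eqVneq x y) => [->|nxy]; first by rewrite r1.
rewrite /= (restrict_rel_live Rpre) ?collapseK //.
case: (boolP ((x \in block i) && (y \in block i))) => [/andP[xi yi]|nb].
  rewrite !collapse_block // eqxx orbF r1 andbT -z01.
  case/blockP: xi nxy => s ->; case/blockP: yi => t -> nst.
  apply/idP/idP=> h; first exact: (rot_fixed_full _ _ Rpre iR Fp_01 h).
  apply: (rot_fixed_full _ _ Rpre iR _ h); by apply: contraNneq nst => ->.
rewrite (rot_fixed_collapse iR) //.
case: (eqVneq (collapse i x)) => [e|_]; last by rewrite orbT.
by rewrite (collapse_eq e nxy) in nb.
Qed.

Lemma expand_relK b i (A B : {set pt}) (R : rel_set) :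
  preorder_on [set x in A | collapse i x == x] B R ->
  restrict_rel i (expand_rel b i R) = R.
Proof.
move=> Rpre; have [r1 r2 r3 r4] := preorder_onP _ _ _ Rpre.
apply/setP=> -[x y]; rewrite inE /=; case: (eqVneq x y) => [->|nxy] /=; first by rewrite r1.
have [cx|ncx] /= := eqVneq (collapse i x) x; last first.
  apply/esym/idP=> xy; have /andP[] := r3 _ _ xy nxy.
  by rewrite !inE (negbTE ncx) andbF.
have [cy|ncy] /= := eqVneq (collapse i y) y; last first.
  apply/esym/idP=> xy; have /andP[] := r3 _ _ xy nxy.
  by rewrite !inE (negbTE ncy) andbF.
exact: expand_rel_live Rpre cx cy.
Qed.

(** Restriction to the points that survive the collapse is inverse to expansion; the conditions for
    [J] carry over because [i] is not in [J]. *)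
Lemma card_fixed_preorders (b : bool) i (A B : {set pt}) J : block i \subset A ->
  (b -> [disjoint block i & B]) -> i \notin J ->
  #|fixed_preorders b i A B J| =
  #|unfixed_preorders [set x in A | collapse i x == x] (collapsed_isolated b i B) J|.
Proof.
move=> sA dB iJ.
apply: (@card_in_can _ _ _ _ (restrict_rel i) (expand_rel b i)) => R.
- rewrite !in_set => /andP[/andP[Rpre RJ] /andP[iR /eqP z01]].
  have [Qpre e] := restrict_relP sA Rpre iR z01; rewrite Qpre /=.
  apply/allP=> j jJ; rewrite -(rot_fixed_expand b Qpre) ?e; first exact: (allP RJ).
  by apply: contraNneq iJ => ->.
- rewrite in_set => /andP[Rpre RJ]; have [Qpre iQ z01] := expand_relP sA dB Rpre.
  rewrite in_set iQ z01 eqxx !andbT in_set Qpre /=.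
  apply/allP=> j jJ; rewrite (rot_fixed_expand b Rpre); first exact: (allP RJ).
  by apply: contraNneq iJ => ->.
- rewrite !in_set => /andP[/andP[Rpre RJ] /andP[iR /eqP z01]].
  by have [_ ->] := restrict_relP sA Rpre iR z01.
- by rewrite in_set => /andP[Rpre _]; apply: expand_relK Rpre.
Qed.

Lemma card_unfixed_cons i (A B : {set pt}) (J : seq 'I_K) :
  #|unfixed_preorders A B J| = (#|unfixed_preorders A B (i :: J)| +
    (#|fixed_preorders true i A B J| + #|fixed_preorders false i A B J|))%N.
Proof.
rewrite -(cardsID [set R | rot_fixed (gen i) R]) addnC; congr addn.
  by congr #|pred_of_set _|; apply/setP=> R; rewrite !inE /= andbCA.
rewrite -(cardsID [set R : rel_set | (inr (i, 0), inr (i, 1)) \in R]); congr addn.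
  by congr #|pred_of_set _|; apply/setP=> R; rewrite !inE eqb_id -!andbA.
by congr #|pred_of_set _|; apply/setP=> R; rewrite !inE eqbF_neg andbC -!andbA.
Qed.

Lemma card_block i : #|block i| = p.
Proof. by rewrite card_imset ?card_Fp // => s t []. Qed.

End Blocks.
Arguments block {p X K} i.

(** * The umbral functional *)

Local Open Scope ring_scope.

Section Functional.

Variable s : nat -> nat -> int.

Definition coef_pairing (u : nat -> int) (q : {poly int}) : int :=
  \sum_(j < size q) q`_j * u j.

Lemma coef_pairing_widen u (q : {poly int}) n : (size q <= n)%N ->
  coef_pairing u q = \sum_(j < n) q`_j * u j.
Proof.
move=> qn; rewrite /coef_pairing (big_ord_widen _ (fun j => q`_j * u j) qn).
rewrite big_mkcond; apply: eq_bigr => j _.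
by case: ltnP => // /(nth_default 0) ->; rewrite mul0r.
Qed.

Lemma coef_pairingB u (q r : {poly int}) :
  coef_pairing u (q - r) = coef_pairing u q - coef_pairing u r.
Proof.
pose n := maxn (size q) (size r).
have qrn : (size (q - r)%R <= n)%N by rewrite /n -(size_polyN r) size_polyD.
rewrite (coef_pairing_widen _ qrn) (@coef_pairing_widen _ q n) ?leq_maxl //.
rewrite (@coef_pairing_widen _ r n) ?leq_maxr // -sumrB.
by apply: eq_bigr => j _; rewrite coefB mulrBl.
Qed.

Lemma coef_pairing0 u : coef_pairing u 0 = 0.
Proof. by rewrite /coef_pairing size_poly0 big_ord0. Qed.

(* The linear functional mapping X^a Y^b to s a b, where X is the inner variable
   ['X%:P] and Y the outer variable ['X]; multiplying by X or Y under it shifts the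
   corresponding argument of s. *)
Definition umbral (P : {poly {poly int}}) : int :=
  \sum_(i < size P) coef_pairing (s^~ i) P`_i.

Lemma umbral_widen (P : {poly {poly int}}) n : (size P <= n)%N ->
  umbral P = \sum_(i < n) coef_pairing (s^~ i) P`_i.
Proof.
move=> Pn; rewrite /umbral (big_ord_widen _ (fun i => coef_pairing (s^~ i) P`_i) Pn).
rewrite big_mkcond; apply: eq_bigr => i _.
by case: ltnP => // /(nth_default 0) ->; rewrite coef_pairing0.
Qed.

Fact umbral_is_zmod_morphism : zmod_morphism umbral.
Proof.
move=> P Q; pose n := maxn (size P) (size Q).
have PQn : (size (P - Q)%R <= n)%N by rewrite /n -(size_polyN Q) size_polyD.
rewrite (umbral_widen PQn) (@umbral_widen P n) ?leq_maxl //.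
rewrite (@umbral_widen Q n) ?leq_maxr // -sumrB.
by apply: eq_bigr => i _; rewrite coefB coef_pairingB.
Qed.

HB.instance Definition _ :=
  GRing.isZmodMorphism.Build {poly {poly int}} int umbral umbral_is_zmod_morphism.

Local Notation E := ('X%:P : {poly {poly int}}).
Local Notation F := ('X : {poly {poly int}}).

Lemma umbral_monomial a b : umbral (E ^+ a * F ^+ b) = s a b.
Proof.
have -> : E ^+ a * F ^+ b = ('X^a : {poly int}) *: 'X^b by rewrite -polyC_exp mul_polyC.
rewrite (@umbral_widen _ b.+1); last first.
  by rewrite (leq_trans (size_scale_leq _ _)) ?size_polyXn.
rewrite (bigD1 ord_max) //= big1 ?addr0 => [|i ib].
  rewrite coefZ coefXn eqxx mulr1 (@coef_pairing_widen _ _ a.+1) ?size_polyXn //.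
  rewrite (bigD1 ord_max) //= big1 ?addr0 => [|j ja]; first by rewrite coefXn eqxx mul1r.
  by move: ja; rewrite -val_eqE /= coefXn => /negbTE ->; rewrite mul0r.
by move: ib; rewrite -val_eqE /= coefZ coefXn => /negbTE ->; rewrite mulr0 coef_pairing0.
Qed.

(** These [P] form an ideal: the polynomials in the two shifts that kill [s] modulo [m]. *)
Definition annihilates (m : int) (P : {poly {poly int}}) : Prop :=
  forall f, (m %| umbral (P * f))%Z.

Lemma annihilates_monomials m P :
  (forall a b, (m %| umbral (P * (E ^+ a * F ^+ b)))%Z) -> annihilates m P.
Proof.
move=> mP f; rewrite -[f]coefK poly_def mulr_sumr raddf_sum; apply: rpred_sum => i _.
rewrite -[f`_i]coefK poly_def scaler_suml mulr_sumr raddf_sum; apply: rpred_sum => j _.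
rewrite -[f`_i`_j]intz scaler_int -scaler_int -[_ *: 'X^i]mul_polyC.
rewrite scaler_int rmorphMz mulrzAl mulrzAr raddfMz -mulrzr.
by rewrite rmorphXn /= dvdz_mulr.
Qed.

Lemma annihilatesM m P Q : annihilates m P -> annihilates m (P * Q).
Proof. by move=> mP f; rewrite -mulrA. Qed.

Lemma annihilatesD m P Q : annihilates m P -> annihilates m Q -> annihilates m (P + Q).
Proof. by move=> mP mQ f; rewrite mulrDl raddfD rpredD. Qed.

(** Each term of the binomial expansion has at least [K] factors [P] or at least [K] factors [Q]. *)
Lemma annihilates_exp_add m K P Q W : annihilates m (P ^+ K) -> annihilates m (Q ^+ K) ->
  annihilates m ((P + Q * W) ^+ (K + K)).
Proof.
move=> mP mQ; rewrite exprDn; elim/big_ind: _ => [f||i _].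
- by rewrite mul0r raddf0 dvdz0.
- exact: annihilatesD.
rewrite -mulr_natr exprMn; have [iK|Ki] := leqP i K.
  have -> : (K + K - i = K + (K - i))%N by lia.
  by rewrite exprD -!mulrA; apply: annihilatesM.
have -> : Q ^+ i = Q ^+ K * Q ^+ (i - K) by rewrite -exprD; congr (_ ^+ _); lia.
by rewrite [X in annihilates _ (X * _)]mulrC -!mulrA; apply: annihilatesM.
Qed.

End Functional.

(** * Inclusion-exclusion over the block rotations *)

Section CountUnfixed.

Variables (p : nat) (X : finType) (K : nat).
Hypothesis p_prime : prime p.

Local Notation pt := (X + 'I_K * 'F_p)%type.
Local Notation E := ('X%:P : {poly {poly int}}).
Local Notation F := ('X : {poly {poly int}}).
Local Notation L := (umbral (fun a b => (num_preorders a b)%:Z)).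

(** The contribution of one block, whose points are isolated if [c] holds: all its [p] points, minus
    the collapse to an isolated point, minus (unless [c]) the collapse to an ordinary one. *)
Definition shift_diff (c : bool) : {poly {poly int}} :=
  if c then F ^+ p - F else E ^+ p - E - F.

Lemma collapsed_domain i (A : {set pt}) : block i \subset A ->
  [set x in A | collapse i x == x] = inr (i, 0) |: (A :\: block i).
Proof.
move=> sA; apply/setP=> x; rewrite !inE.
have [xi|xi] /= := boolP (x \in block i); last first.
  rewrite collapse_notin // eqxx andbT; case: eqVneq xi => //= ->.
  by rewrite mem_block eqxx.
by rewrite collapse_block // (subsetP sA) // orbF eq_sym.
Qed.

Lemma disjoint_blocks i j : i != j -> [disjoint (block i : {set pt}) & block j].
Proof.
move=> nij; apply/pred0P=> x /=; apply/negP=> /andP[/blockP[t ->]].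
by rewrite mem_block (negbTE nij).
Qed.

Lemma fixed_full_isolated i (A B : {set pt}) J : block i \subset B ->
  fixed_preorders true i A B J = set0.
Proof.
move=> sB; apply/setP=> R; rewrite !inE; apply/negP=> /andP[/andP[Rpre _]].
case/andP=> iR /eqP z01; have [_ _ _ r4] := preorder_onP _ _ _ Rpre.
have z10 := rot_fixed_full 1 0 Rpre iR (Fp_01 p) z01.
have z0B : inr (i, 0) \in B by apply: (subsetP sB); rewrite mem_block.
have := r4 _ _ z0B z01 z10 => -[/eqP].
by rewrite modn_small.
Qed.

(** Induction on [J], solving [card_unfixed_cons] for the term of [i :: J]; [a] and [b] count the
    ordinary and the isolated points outside the blocks of [J]. *)
Lemma card_unfixed_preorders (c : bool) (J : seq 'I_K) (A B : {set pt}) a b :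
  uniq J -> B \subset A ->
  (forall i, i \in J -> block i \subset A) ->
  (forall i, i \in J -> if c then block i \subset B else [disjoint block i & B]) ->
  #|A :\: B| = (a + (if c then 0 else p * size J))%N ->
  #|B| = (b + (if c then p * size J else 0))%N ->
  #|unfixed_preorders A B J|%:Z = L (shift_diff c ^+ size J * (E ^+ a * F ^+ b)).
Proof.
elim: J A B a b => [|i J IH] A B a b.
  rewrite muln0 if_same !addn0 => _ sBA _ _ <- <-.
  rewrite expr0 mul1r umbral_monomial -(card_preorder_on sBA); congr (Posz #|pred_of_set _|).
  by apply/setP=> R; rewrite !inE andbT.
case/andP=> iJ uJ sBA JA JB aE bE.
have sA : block i \subset A by apply: JA; rewrite inE eqxx.
have sB : if c then block i \subset B else [disjoint block i & B].
  by apply: JB; rewrite inE eqxx.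
have JA' j : j \in J -> block j \subset A by move=> jJ; apply: JA; rewrite inE jJ orbT.
have JB' j : j \in J -> if c then block j \subset B else [disjoint block j & B].
  by move=> jJ; apply: JB; rewrite inE jJ orbT.
have JD j : j \in J -> forall S : {set pt}, block j \subset S ->
    block j \subset inr (i, 0) |: (S :\: block i).
  move=> jJ S jS; apply: subset_trans (subsetUr _ _).
  rewrite subsetD jS disjoint_blocks //; by apply: contraNneq iJ => <-.
have z0i : (inr (i, 0) : pt) \in block i by rewrite mem_block.
have cntf := card_fixed_preorders sA (fun f => False_ind [disjoint block i & B] (notF f)) iJ.
rewrite (collapsed_domain sA) /= in cntf.
have DB : B :\: block i \subset A :\: block i by apply: setSD.
have aE' : (#|A :\: B| = #|(A :\: block i) :\: B| + (if c then 0 else p))%N.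
  rewrite -(cardsID (block i) (A :\: B)) addnC; congr addn.
    by rewrite !setDDl setUC.
  case: (c) sB => sB.
    apply/eqP; rewrite cards_eq0; apply/eqP/setP=> x; rewrite !inE.
    by apply/negP=> /andP[/andP[/negP xB _] /(subsetP sB)].
  apply: etrans (card_block X p_prime i); congr #|pred_of_set _|; apply/setP=> x; rewrite !inE.
  have [xi|] := boolP (x \in block i); rewrite ?andbF // andbT.
  by rewrite (subsetP sA _ xi) (disjointFr sB xi).
have bE' : (#|B| = #|B :\: block i| + (if c then p else 0))%N.
  rewrite -(cardsID (block i) B) addnC; congr addn.
  case: (c) sB => sB.
    by apply: etrans (card_block X p_prime i); congr #|pred_of_set _|; apply/setIidPr.
  by apply/eqP; rewrite cards_eq0 setIC setI_eq0.
(* A discrete block leaves one more isolated point. *)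
have cnt0 : #|fixed_preorders false i A B J|%:Z =
    L (shift_diff c ^+ size J * (E ^+ a * F ^+ b.+1)).
  rewrite cntf; apply: IH => //.
  - by apply: setUS.
  - by move=> j jJ; apply: JD => //; apply: JA'.
  - move=> j jJ; have := JB' j jJ; case: (c) => jB; first exact: JD.
    rewrite disjoint_sym disjoints_subset subUset sub1set inE mem_block -disjoints_subset.
    have -> : i == j = false by apply: contraNF iJ => /eqP ->.
    by rewrite /=; apply: disjointWl (subsetDl _ _) _; rewrite disjoint_sym.
  - have -> : (inr (i, 0) |: A :\: block i) :\: (inr (i, 0) |: B :\: block i) =
              (A :\: block i) :\: B.
      apply/setP=> x; rewrite !inE; case: (eqVneq x) => [->|_] /=.
        by rewrite z0i /= andbF.
      by case: (x \in block i); rewrite //= ?andbF.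
    by move: aE; rewrite aE' /=; case: (c); lia.
  - rewrite cardsU1 !inE z0i /=; move: bE; rewrite bE' /=; case: (c); lia.
(* A full block leaves one more ordinary point, and cannot occur among isolated points. *)
have cnt1 : #|fixed_preorders true i A B J|%:Z =
    if c then 0 else L (shift_diff c ^+ size J * (E ^+ a.+1 * F ^+ b)).
  case: (c) sB JB' aE aE' bE bE' IH => sB JB' aE aE' bE bE' IH.
    by rewrite (fixed_full_isolated _ _ sB) cards0.
  rewrite (card_fixed_preorders sA (fun _ => sB) iJ) (collapsed_domain sA) /=.
  have BD : B :\: block i = B by apply/setDidPl; rewrite disjoint_sym.
  rewrite BD in DB *; apply: IH => //.
  - exact: subset_trans DB (subsetUr _ _).
  - by move=> j jJ; apply: JD => //; apply: JA'.
  - have -> : (inr (i, 0) |: A :\: block i) :\: B = inr (i, 0) |: (A :\: block i) :\: B.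
      apply/setP=> x; rewrite !inE; case: (eqVneq x) => [->|_] //=.
      by rewrite (disjointFr sB z0i).
    rewrite cardsU1 !inE z0i /= andbF /=; move: aE; rewrite aE' /=; lia.
(* Without a condition on its rotation, block [i] adds its [p] points to the base. *)
have cntJ : #|unfixed_preorders A B J|%:Z =
    L (shift_diff c ^+ size J * (if c then E ^+ a * F ^+ (p + b) else E ^+ (p + a) * F ^+ b)).
  case: (c) sB JB' aE aE' bE bE' IH {cnt0 cnt1} => sB JB' aE aE' bE bE' IH;
    apply: IH => //; move: aE bE; rewrite /=; lia.
have := card_unfixed_cons i A B J.
move/(congr1 Posz); rewrite !PoszD cnt0 cnt1 cntJ => /esym/(canRL (addrK _)) ->.
rewrite /shift_diff; case: (c); rewrite ?add0r -?raddfD -raddfB; congr L.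
  by rewrite exprSr exprS exprD; ring.
by rewrite exprSr !exprS exprD; ring.
Qed.

End CountUnfixed.

(** * Orbits of the block rotations *)

(* D is a minimal set of coordinates separating H; a coordinate in D has the same
   zeros as some coordinate outside D, and distinct coordinates get distinct partners. *)
Lemma card_paired_coordinates (p K : nat) (H : {set 'rV['F_p]_K}) : prime p ->
  {in H &, forall g h : 'rV['F_p]_K, g - h \in H} ->
  (forall i, (forall h, h \in H -> h 0 i = 0) \/
     exists2 j, j != i & forall h, h \in H -> (h 0 i == 0) = (h 0 j == 0)) ->
  exists2 d : nat, (d + d <= K)%N & (#|H| <= p ^ d)%N.
Proof.
move=> p_prime Hsub Hpair.
pose P (D : {set 'I_K}) :=
  [forall h in H, [forall i in D, h 0 i == 0] ==> (h == 0)].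
have PP (D : {set 'I_K}) :
    reflect (forall h, h \in H -> (forall i, i \in D -> h 0 i = 0) -> h = 0) (P D).
  apply: (iffP forall_inP) => [PD h hH hD|PD h hH].
    apply/eqP; apply: (implyP (PD h hH)); apply/forall_inP=> i iD.
    by rewrite hD.
  apply/implyP=> /forall_inP hD; apply/eqP; apply: PD => // i iD; exact/eqP/hD.
have [D /minsetP[/PP PD Dmin]] : {D | minset P D}.
  apply: ex_minset; exists setT; apply/PP=> h hH h0.
  by apply/rowP=> i; rewrite h0 // mxE.
(* By minimality of [D], some element of [H] is nonzero at [i] and zero on the rest of [D]. *)
have wit i : i \in D -> exists h, [/\ h \in H, h 0 i != 0
    & forall k, k \in D -> k != i -> h 0 k = 0].
  move=> iD; have : ~~ P (D :\ i).
    apply/negP=> PDi; have := Dmin _ PDi (subsetDl _ _) => /setP/(_ i).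
    by rewrite !inE eqxx iD.
  rewrite negb_forall_in => /exists_inP[h hH]; rewrite negb_imply.
  case/andP=> /forall_inP h0 hn0; exists h; split=> //; last first.
    by move=> k kD ki; apply/eqP/h0; rewrite !inE ki.
  apply: contraNneq hn0 => hi; apply/eqP; apply: PD => // k kD.
  by have [->//|ki] := eqVneq k i; apply/eqP/h0; rewrite !inE ki.
pose Q i j := (j != i) && [forall h in H, (h 0 i == 0) == (h 0 j == 0)].
(* On [D] the default is never taken: the witness excludes the first alternative of [Hpair]. *)
pose f i := odflt i [pick j | Q i j].
have fP i : i \in D -> f i != i /\ forall h, h \in H -> (h 0 i == 0) = (h 0 (f i) == 0).
  move=> iD; rewrite /f; case: pickP => [j /andP[ji /forall_inP jH]|no] /=.
    by split=> // h hH; rewrite (eqP (jH h hH)).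
  have [h [hH hi _]] := wit i iD.
  case: (Hpair i) => [/(_ h hH) h0|[j ji jH]]; first by rewrite h0 eqxx in hi.
  have := no j; rewrite /Q ji /= => /negbT/negP[].
  by apply/forall_inP=> g gH; rewrite jH.
(* The witness of [i] is nonzero at [f i] but zero on the rest of [D]. So [f] is injective, and
   below [f @: D] avoids [D], whence twice [#|D|] is at most [K]. *)
have fI : {in D &, injective f}.
  move=> i k iD kD e; apply/eqP; apply: contraTT isT => nik.
  have [h [hH hi h0]] := wit i iD.
  have [_ /(_ h hH) e1] := fP i iD; have [_ /(_ h hH)] := fP k kD.
  by rewrite -e -e1 (negbTE hi) h0 ?eqxx // eq_sym.
exists #|D|.
  rewrite -{1}(card_in_imset fI) -[K in (_ <= K)%N]card_ord -cardsT -cardsUI.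
  have -> : (f @: D) :&: D = set0.
    apply/setP=> k; rewrite !inE; apply/negP=> /andP[/imsetP[i iD ->] fD].
    have [h [hH hi h0]] := wit i iD; have [fi /(_ h hH)] := fP i iD.
    by rewrite (negbTE hi) h0 ?eqxx.
  by rewrite cards0 addn0 subset_leq_card // subsetT.
(* Elements of [H] are determined by their values on [D], so [H] embeds in the functions supported
   on [D]. *)
pose g (h : 'rV['F_p]_K) := [ffun i => if i \in D then h 0 i else 0].
have gI : {in H &, injective g}.
  move=> h h' hH hH' /ffunP e; apply/eqP; rewrite -subr_eq0; apply/eqP.
  apply: PD => [|i iD]; first exact: Hsub.
  by have := e i; rewrite !ffunE iD !mxE => ->; rewrite subrr.
have -> : (p ^ #|D|)%N = #|pffun_on (0 : 'F_p) (mem D) (mem predT)|.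
  by rewrite card_pffun_on; congr (_ ^ _)%N; rewrite card_Fp.
rewrite -(card_in_imset gI); apply: subset_leq_card; apply/subsetP=> _ /imsetP[h hH ->].
apply/pffun_onP; split=> [|y _ //].
by apply/supportP=> i iD; rewrite ffunE (negbTE iD).
Qed.

(** * Stabilizers and divisibility of the orbit sizes *)

Section Divisibility.

Variables (p : nat) (X : finType) (K : nat).
Hypothesis p_prime : prime p.

Local Notation pt := (X + 'I_K * 'F_p)%type.
Local Notation rel_set := {set pt * pt}.
Local Notation gen i := (delta_mx (0 : 'I_1) i : 'rV['F_p]_K).

Lemma rot_fixedD (g h : 'rV['F_p]_K) (R : rel_set) :
  rot_fixed g R -> rot_fixed h R -> rot_fixed (g + h) R.
Proof.
move=> /rot_fixedP gR /rot_fixedP hR; apply/rot_fixedP=> x y.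
by rewrite !brotD hR gR.
Qed.

Lemma rot_fixedB (g h : 'rV['F_p]_K) (R : rel_set) :
  rot_fixed g R -> rot_fixed h R -> rot_fixed (g - h) R.
Proof.
by move=> gR hR; rewrite -scaleN1r; apply: rot_fixedD => //; apply: rot_fixed_scale.
Qed.

(** The multiple of [h] with coordinate 1 at [i] acts on [x] and [y] exactly as the rotation of
    block [i]. *)
Lemma rot_fixed_gen (R : rel_set) i h x y : rot_fixed h R -> h 0 i != 0 ->
  (forall k t, x = inr (k, t) -> k != i -> h 0 k = 0) ->
  (forall k t, y = inr (k, t) -> k != i -> h 0 k = 0) ->
  ((brot (gen i) x, brot (gen i) y) \in R) = ((x, y) \in R).
Proof.
move=> hR hi xh yh.
have rotE z : (forall k t, z = inr (k, t) -> k != i -> h 0 k = 0) ->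
    brot (gen i) z = brot ((h 0 i)^-1 *: h) z.
  case: z => [//|[k t]] /(_ k t erefl) zh /=; rewrite !mxE /=.
  by have [->|/zh ->] := eqVneq k i; rewrite ?mulVf ?mulr0.
by rewrite !rotE //; have /rot_fixedP := rot_fixed_scale (h 0 i)^-1 hR.
Qed.

(* Invariance is a condition on pairs of points, hence on at most two coordinates. *)
Lemma stabilizer_paired (R : rel_set) i : ~~ rot_fixed (gen i) R ->
  (forall h, rot_fixed h R -> h 0 i = 0) \/
  exists2 j, j != i & forall h, rot_fixed h R -> (h 0 i == 0) = (h 0 j == 0).
Proof.
move=> niR; case: (boolP [exists h, rot_fixed h R && (h 0 i != 0)]); last first.
  rewrite negb_exists => /forallP no; left=> h hR; apply/eqP.
  by have := no h; rewrite hR /= negbK.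
case/existsP=> h0 /andP[h0R h0i]; right.
have [x [y xy]] : exists x y, ((brot (gen i) x, brot (gen i) y) \in R) != ((x, y) \in R).
  move: niR; rewrite negb_forall => /existsP[x]; rewrite negb_forall => /existsP[y xy].
  by exists x, y.
(* One implication suffices: if [h] vanished at [i] but not at [j], subtracting a multiple of [h]
   from [h0] would cancel coordinate [j] and keep coordinate [i] nonzero. *)
suff [j ji jR] : exists2 j, j != i &
    forall h, rot_fixed h R -> h 0 j = 0 -> h 0 i = 0.
  exists j => // h hR; apply/idP/idP; last by move/eqP/(jR h hR)/eqP.
  move=> /eqP hi; apply: contraTT h0i => hj; rewrite negbK.
  have := rot_fixedB h0R (rot_fixed_scale (h0 0 j / h 0 j) hR) => /jR.
  by rewrite !mxE hi mulr0 subr0 divfK // subrr => ->.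
have rot_id (z : pt) : (forall t, z <> inr (i, t)) -> brot (gen i) z = z.
  move=> zi; have := @rot_gen_scale_notin p X K i 1 z; rewrite scale1r; apply.
  by apply/negP=> /blockP[t /zi].
have useR h (z : pt) j : z = x \/ z = y -> j != i -> (exists t, z = inr (j, t)) ->
    (exists t, x = inr (i, t)) \/ (exists t, y = inr (i, t)) ->
    rot_fixed h R -> h 0 j = 0 -> h 0 i = 0.
  move=> zxy ji [t zt] xyi hR hj; apply/eqP; apply: contraTT xy => hi; rewrite negbK.
  apply/eqP; apply: (rot_fixed_gen hR hi) => k u e ki;
   case: xyi => -[v ev]; case: zxy zt => -> zt;
   by [move: ki; move: e; rewrite ev => -[->]; rewrite eqxx
      | move: e; rewrite zt => -[<- _] 
      | move: zt ji; rewrite ev => -[->]; rewrite eqxx].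
have {}useR j (z : pt) : z = x \/ z = y -> j != i -> (exists t, z = inr (j, t)) ->
    (exists t, x = inr (i, t)) \/ (exists t, y = inr (i, t)) ->
    exists2 j, j != i & forall h, rot_fixed h R -> h 0 j = 0 -> h 0 i = 0.
  by move=> h1 h2 h3 h4; exists j => // h; apply: useR h1 h2 h3 h4.
have xyi : (exists t, x = inr (i, t)) \/ (exists t, y = inr (i, t)).
  have [/blockP|xi] := boolP (x \in block i); first by left.
  have [/blockP|yi] := boolP (y \in block i); first by right.
  case/negP: xy; rewrite !rot_id //.
    by move=> t e; rewrite e mem_block eqxx in yi.
  by move=> t e; rewrite e mem_block eqxx in xi.
(* Either [z] lies in another block [j], which is then the partner of [i], or it imposes no
   condition on [h0]. If neither point gives a partner, [h0] forces invariance at [x] and [y]. *)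
have outside (z : pt) : (exists2 j, j != i & exists t, z = inr (j, t)) \/
    (forall k t, z = inr (k, t) -> k != i -> h0 0 k = 0).
  case: z => [z|[j t]]; first by right.
  have [ji|ji] := eqVneq j i; last by left; exists j => //; exists t.
  by right=> k u [<- _]; rewrite ji eqxx.
have [[j ji xj]|x0] := outside x; first exact: (useR j x (or_introl erefl)).
have [[j ji yj]|y0] := outside y; first exact: (useR j y (or_intror erefl)).
by case/eqP: xy; apply: rot_fixed_gen h0R h0i x0 y0.
Qed.

Definition rot_rel (R : rel_set) (g : 'rV['F_p]_K) : rel_set :=
  [set xy | (brot g xy.1, brot g xy.2) \in R].

Lemma rot_rel0 R : rot_rel R 0 = R.
Proof. by apply/setP=> -[x y]; rewrite inE /= !brot0. Qed.

(** Pulling back reverses the order of the rotations; commutativity still makes it an action. *)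
Lemma rot_relD R (g h : 'rV['F_p]_K) : rot_rel R (g + h) = rot_rel (rot_rel R g) h.
Proof. by apply/setP=> -[x y]; rewrite !inE /= addrC !brotD. Qed.

Lemma rot_rel_eq R g : (rot_rel R g == R) = rot_fixed g R.
Proof.
apply/eqP/rot_fixedP=> [/setP e x y|e].
  by have := e (x, y); rewrite inE.
by apply/setP=> -[x y]; rewrite inE e.
Qed.

Definition rot_action : {action 'rV['F_p]_K &-> rel_set} :=
  TotalAction rot_rel0 rot_relD.

Lemma rot_rel_unfixed (A B : {set pt}) J R g :
  (forall h x, (brot h x \in A) = (x \in A)) -> (forall h x, (brot h x \in B) = (x \in B)) ->
  R \in unfixed_preorders A B J -> rot_rel R g \in unfixed_preorders A B J.
Proof.
move=> gA gB; rewrite !in_set => /andP[/preorder_onP[r1 r2 r3 r4] RJ]; apply/andP; split.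
  have rotI : injective (brot g : pt -> pt).
    by move=> x y /(congr1 (brot (- g))); rewrite -!brotD subrr !brot0.
  apply/preorder_onP; split=> [x|x y z|x y|x y]; rewrite ?inE /=.
  - exact: r1.
  - exact: r2.
  - by move=> xy nxy; have := r3 _ _ xy; rewrite (inj_eq rotI) !gA; apply.
  - by move=> xB xy yx; apply: rotI; apply: r4; rewrite ?gB.
apply/allP=> i /(allP RJ); apply: contraNN; rewrite -!rot_rel_eq => /eqP e.
have := congr1 (rot_rel^~ (- g)) e; rewrite -!rot_relD.
by rewrite addrC subrK subrr rot_rel0 => ->.
Qed.

(** Stabilizers have at most [p ^ d] elements with [d + d <= K], so every orbit has size [p ^ k]
    with [k >= K - d >= r]. *)
Lemma dvdn_card_unfixed (A B : {set pt}) r : (r + r <= K)%N ->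
  (forall h x, (brot h x \in A) = (x \in A)) -> (forall h x, (brot h x \in B) = (x \in B)) ->
  (p ^ r %| #|unfixed_preorders A B (enum 'I_K)|)%N.
Proof.
move=> rK gA gB; set S := unfixed_preorders _ _ _.
have Sact : [acts [set: 'rV['F_p]_K]%G, on S | rot_action].
  apply/actsP=> g _ R; apply/idP/idP=> /= [gS|]; last exact: rot_rel_unfixed.
  have := rot_rel_unfixed (- g) gA gB gS.
  by rewrite -rot_relD subrr rot_rel0.
rewrite -(acts_sum_card_orbit Sact); apply: dvdn_sum => _ /imsetP[R RS ->].
set G := [set: _]%G.
have Gcard : #|G| = (p ^ K)%N by rewrite cardsT card_mx card_Fp // mul1n.
set C := 'C_G[R | rot_action]%g.
have CE g : (g \in C) = rot_fixed g R.
  by rewrite !inE sub1set inE /= rot_rel_eq.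
have [||d dK Cd] := @card_paired_coordinates p K C p_prime.
- by move=> g h; rewrite !CE; apply: rot_fixedB.
- move=> i; have : ~~ rot_fixed (gen i) R.
    by move: RS; rewrite inE => /andP[_ /allP]; apply; rewrite mem_enum.
  case/stabilizer_paired=> [iR|[j ji jR]]; first by left=> g; rewrite CE; apply: iR.
  by right; exists j => // g; rewrite CE; apply: jR.
have := Lagrange (subsetIl G 'C[R | rot_action]%g); rewrite -/C card_orbit Gcard => GC.
have /(dvdn_pfactor _ _ p_prime)[k kK iE] : (#|G : C|%g %| p ^ K)%N.
  by rewrite -GC dvdn_mull.
rewrite iE in GC *; apply: dvdn_exp2l.
have : (p ^ K <= p ^ (d + k))%N by rewrite -GC expnD leq_mul2r Cd orbT.
rewrite leq_exp2l ?prime_gt1 //; lia.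
Qed.

End Divisibility.

(** On a monomial, the functional counts the unfixed preorders on [a + b] points with [r + r]
    adjoined blocks; [isB] marks the isolated points. *)
Lemma annihilates_shift_diff (p r : nat) (c : bool) : prime p ->
  annihilates (fun a b => (num_preorders a b)%:Z) (p ^ r)%:Z (shift_diff p c ^+ (r + r)).
Proof.
move=> p_prime; apply: annihilates_monomials => a b.
set K := (r + r)%N; pose X := ('I_a + 'I_b)%type.
pose isB (x : X + 'I_K * 'F_p) :=
  match x with inl (inl _) => false | inl (inr _) => true | inr _ => c end.
have KE : size (enum 'I_K) = K by rewrite size_enum_ord.
have dvd := @dvdn_card_unfixed p X K p_prime setT [set x | isB x] r (leqnn _).
have cardB : #|[set x | isB x]| = (b + (if c then p * K else 0))%N.
  rewrite -sum1dep_card big_sumType big_sumType /= big_pred0 // add0n.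
  rewrite sum_nat_const cardT size_enum_ord muln1; congr addn.
  case: (c); last by rewrite big_pred0.
  by rewrite sum_nat_const card_prod card_ord card_Fp // muln1 mulnC.
have cardA : #|setT :\: [set x | isB x]| = (a + (if c then 0 else p * K))%N.
  have -> : setT :\: [set x | isB x] = [set x | ~~ isB x].
    by apply/setP=> x; rewrite !inE andbT.
  rewrite -sum1dep_card big_sumType big_sumType /= [X in (_ + X + _)%N]big_pred0 // addn0.
  rewrite sum_nat_const cardT size_enum_ord muln1; congr addn.
  case: (c); first by rewrite big_pred0.
  by rewrite sum_nat_const card_prod card_ord card_Fp // muln1 mulnC.
have := @card_unfixed_preorders p X K p_prime c (enum 'I_K) setT [set x | isB x] a b.
rewrite KE => <- //.
- apply: dvd => g x; first by rewrite !inE.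
  by rewrite !inE; case: x => // -[].
- exact: enum_uniq.
- move=> i _; case: (boolP c) => cE.
    by apply/subsetP=> _ /blockP[t ->]; rewrite inE.
  by apply/pred0P=> x /=; apply/negP=> /andP[/blockP[t ->]]; rewrite inE /= (negbTE cE).
Qed.

(** * Recurrences *)

Local Notation N := (fun a b : nat => (num_preorders a b)%:Z).

Definition artin_schreier (p : nat) : {poly int} := 'X^p - 'X.

Lemma artin_schreier_monic p : (1 < p)%N -> artin_schreier p \is monic.
Proof.
move=> p1; rewrite monicE lead_coefDl ?lead_coefXn //.
by rewrite size_polyN size_polyX size_polyXn.
Qed.

Lemma size_artin_schreier p : (1 < p)%N -> size (artin_schreier p) = p.+1.
Proof. by move=> p1; rewrite size_polyDl size_polyXn // size_polyN size_polyX. Qed.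

(** The result of eliminating F from F^p - F and E^p - E - F. *)
Definition artin_schreier2 (p : nat) : {poly int} := artin_schreier p ^+ p - artin_schreier p.

Lemma artin_schreier2_monic p : (1 < p)%N -> artin_schreier2 p \is monic.
Proof.
move=> p1; have asM := artin_schreier_monic p1.
have szX : size (artin_schreier p ^+ p) = (p * p).+1.
  rewrite -[LHS]prednK ?size_exp ?size_artin_schreier //.
  by rewrite size_poly_gt0 monic_neq0 // monic_exp.
rewrite monicE lead_coefDl; first by rewrite lead_coef_exp (monicP asM) expr1n.
by rewrite size_polyN szX size_artin_schreier // ltnS; nia.
Qed.

Lemma annihilates_artin_schreier p r : prime p ->
  annihilates N (p ^ r)%:Z (map_poly polyC (artin_schreier p ^+ (r + r))).
Proof.
move=> p_prime.
have -> : map_poly polyC (artin_schreier p ^+ (r + r)) = shift_diff p true ^+ (r + r).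
  by rewrite rmorphXn /= raddfB /= map_polyXn map_polyX.
exact: annihilates_shift_diff.
Qed.

(** With u = E^p - E - F one has E^p - E = u + F, so the polynomial is F^p - F plus a multiple of u.
    The power [r + r] of either annihilates, and [annihilates_exp_add] doubles the exponent. *)
Lemma annihilates_artin_schreier2 p r : prime p ->
  annihilates N (p ^ r)%:Z (artin_schreier2 p ^+ (r + r + (r + r)))%:P.
Proof.
move=> p_prime.
pose u : {poly {poly int}} := 'X%:P ^+ p - 'X%:P - 'X.
have [W WE] : exists W, (artin_schreier2 p)%:P = ('X ^+ p - 'X) + u * W.
  have asE : (artin_schreier p)%:P = u + 'X by rewrite rmorphB rmorphXn subrK.
  have := subrXX (u + 'X) 'X p; rewrite addrK => dE.
  exists (\sum_(i < p) (u + 'X) ^+ (p.-1 - i) * 'X ^+ i - 1).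
  rewrite mulrBr mulr1 -dE rmorphB rmorphXn /= asE; move: ('X : {poly {poly int}}) => y.
  by move: ((u + y) ^+ p) (y ^+ p) => a b; move: (u) => v; ring.
rewrite polyC_exp WE; apply: annihilates_exp_add.
  exact: (@annihilates_shift_diff p r true).
exact: (@annihilates_shift_diff p r false).
Qed.

(** A general [phi] covers both embeddings: [polyC] for shifts of the first argument,
    [map_poly polyC] for the second. *)
Lemma umbral_shift (phi : {rmorphism {poly int} -> {poly {poly int}}}) (Q : {poly int}) n d :
  (size Q <= d)%N ->
  umbral N (phi Q * phi 'X ^+ n) = \sum_(i < d) Q`_i * umbral N (phi 'X ^+ (n + i)).
Proof.
move=> Qd; rewrite [in LHS](_ : Q = \sum_(i < d) 'X^i *~ Q`_i); last first.
  rewrite -{1}[Q]coefK poly_def (big_ord_widen _ (fun i => Q`_i *: 'X^i) Qd) big_mkcond.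
  apply: eq_bigr => i _; case: ltnP => [_|/(nth_default 0) ->]; last by rewrite mulr0z.
  by rewrite -scaler_int intz.
rewrite rmorph_sum mulr_suml raddf_sum; apply: eq_bigr => i _.
by rewrite rmorphMz rmorphXn mulrzAl raddfMz -mulrzl intz -exprD addnC.
Qed.

Lemma MC_finite_umbral (phi : {rmorphism {poly int} -> {poly {poly int}}})
    (q : nat -> nat -> {poly int}) :
  (forall p r, prime p -> q p r \is monic) ->
  (forall p r, prime p -> annihilates N (p ^ r)%:Z (phi (q p r))) ->
  MC_finite (fun n => umbral N (phi 'X ^+ n)).
Proof.
(* Each prime factor of [m] is handled by its own factor of [Q]. The extra ['X] keeps the order
   positive even for an empty product, as for [m = 1]. *)
move=> qM qA m m0; pose Q := 'X * \prod_(p < m.+1 | prime p) q p (logn p m).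
have QM : Q \is monic.
  by rewrite rpredM ?monicX // rpred_prod // => p /qM.
have QA : annihilates N m%:Z (phi Q).
  move=> f; rewrite dvdzE; apply/dvdn_partP => // p pm.
  have pp : prime p by move: pm; rewrite mem_primes => /andP[].
  have pm1 : (p < m.+1)%N by move: pm; rewrite mem_primes ltnS => /and3P[_ _ /dvdn_leq]; apply.
  rewrite p_part /Q (bigD1 (Ordinal pm1)) //= !rmorphM mulrCA -!mulrA.
  by rewrite -(absz_nat (p ^ _)) -dvdzE; apply: qA.
have Q1 : (1 < size Q)%N.
  rewrite /Q mulrC size_mulX; last by apply: monic_neq0; rewrite rpred_prod // => p /qM.
  rewrite ltnS size_poly_gt0; apply: monic_neq0; rewrite rpred_prod // => p /qM; exact.
exists (size Q).-1, 1, (fun i => - Q`_i); split=> //; first by case: (size Q) Q1 => // -[].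
move=> n _; apply/eqP; rewrite eqz_mod_dvd.
have := QA (phi 'X ^+ n); rewrite (umbral_shift _ _ (leqnn _)).
have -> : size Q = (size Q).-1.+1 by case: (size Q) Q1.
rewrite big_ord_recr /= [Q`_ _](monicP QM) mul1r addrC => h.
by rewrite -sumrN; under eq_bigr do rewrite mulNr opprK.
Qed.

Lemma eq_MC_finite s t : s =1 t -> MC_finite s -> MC_finite t.
Proof.
move=> e sMC m m0; have [p [q [c [p0 q0 h]]]] := sMC m m0.
by exists p, q, c; split=> // n nq; rewrite -e h //; under eq_bigr do rewrite e.
Qed.

Lemma MC_finite_num_topologies : MC_finite (fun n => (num_topologies n)%:Z).
Proof.
apply: (@eq_MC_finite (fun n => umbral N (polyC 'X ^+ n))).
  by move=> n; rewrite num_topologiesE -[RHS](umbral_monomial N) expr0 mulr1.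
apply: (@MC_finite_umbral polyC (fun p r => artin_schreier2 p ^+ (r + r + (r + r)))).
  by move=> p r /prime_gt1 /artin_schreier2_monic; apply: monic_exp.
by move=> p r; apply: annihilates_artin_schreier2.
Qed.

Lemma MC_finite_num_T0_topologies : MC_finite (fun n => (num_T0_topologies n)%:Z).
Proof.
apply: (@eq_MC_finite (fun n => umbral N (map_poly polyC 'X ^+ n))).
  by move=> n; rewrite num_T0_topologiesE -[RHS](umbral_monomial N) expr0 mul1r map_polyX.
apply: (@MC_finite_umbral (map_poly polyC) (fun p r => artin_schreier p ^+ (r + r))).
  by move=> p r /prime_gt1 /artin_schreier_monic; apply: monic_exp.
by move=> p r; apply: annihilates_artin_schreier.
Qed.

(** * Growth and failure of C-finiteness *)

Lemma C_finite_exp_bound s : C_finite s ->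
  exists C M : nat, forall n, (`|s n| <= C * M ^ n)%N.
Proof.
(* [C] will bound the first [q + p] values; the successor makes [M] positive, so its powers are
   monotone. *)
case=> p [q [c rec]]; pose M := (\sum_(i < p) `|c i|)%N.+1.
pose C := (\sum_(j < q + p) `|s j|)%N; exists C, M => n.
elim/ltn_ind: n => n IH; have [nqp|nqp] := ltnP n (q + p).
  apply: (@leq_trans C); last by rewrite leq_pmulr // expn_gt0.
  by rewrite /C (bigD1 (Ordinal nqp)) //= leq_addr.
have [k kq kE] : exists2 k, (q <= k)%N & n = (k + p)%N by exists (n - p)%N; lia.
rewrite kE rec //; apply: (@leq_trans (\sum_(i < p) absz (c i * s (k + i)%N)%R)%N).
  elim/big_rec2: _ => // i x y _; move: (c i * _) => z; lia.
apply: (@leq_trans (\sum_(i < p) `|c i| * (C * M ^ n.-1))%N).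
  apply: leq_sum => i _; rewrite abszM leq_mul2l; apply/orP; right.
  have ip := ltn_ord i; apply: leq_trans (IH _ _) _; first by lia.
  by rewrite leq_mul2l leq_pexp2l ?orbT //; lia.
(* If [n = 0], where [n.-1] truncates, then [p = 0] and the sum is empty. *)
rewrite -big_distrl /= -kE; case: (posnP n) => [n0|n0].
  by rewrite big1 // => i; have := ltn_ord i; lia.
rewrite -[in X in (_ <= X)%N](prednK n0) expnS mulnCA.
by rewrite leq_mul2l leq_mul2r leqnSn !orbT.
Qed.

Lemma not_C_finite_superexp (s : nat -> nat) :
  (forall k, 2 ^ (k * k) <= s (k + k))%N -> ~ C_finite (fun n => (s n)%:Z).
Proof.
move=> s_ge /C_finite_exp_bound[C [M bound]].
(* Since [C <= 2 ^ C] and [M <= 2 ^ M], it is enough that [k * k] exceeds C + 2kM. *)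
pose k := (M + M + C).+1.
have := leq_trans (s_ge k) (bound (k + k)%N); apply/negP; rewrite -ltnNge.
apply: (@leq_ltn_trans (2 ^ C * (2 ^ M) ^ (k + k))%N).
  by apply: leq_mul; rewrite ?leq_exp2r // ltnW // ltn_expl.
rewrite -expnM -expnD ltn_exp2l // /k; nia.
Qed.

Theorem theorem8 :
  (~ C_finite (fun n : nat => (num_topologies n)%:Z%R) /\
   ~ C_finite (fun n : nat => (num_T0_topologies n)%:Z%R)) /\
  (MC_finite (fun n : nat => (num_topologies n)%:Z%R) /\
   MC_finite (fun n : nat => (num_T0_topologies n)%:Z%R)).
Proof.
have T0_ge k : (2 ^ (k * k) <= num_T0_topologies (k + k))%N.
  by rewrite num_T0_topologiesE num_preorders_lower_bound.
split; last by split; [apply: MC_finite_num_topologies | apply: MC_finite_num_T0_topologies].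
split; apply: not_C_finite_superexp => k //.
(* The lower bound passes to all topologies, as the T0 ones are among them. *)
apply: leq_trans (T0_ge k) _; apply: subset_leq_card; apply/subsetP=> O.
by rewrite !inE => /andP[].
Qed.
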